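(* Let $n\ge 1$ be an integer. The closure $\overline{\operatorname{conv}}(\psi_n)$ of the convex hull of the constructible region $\psi_n\subset\mathbb{R}^{2^n-1}$ is equal to $BT_n$.
   Context: Write $[n]=\{1,\dots,n\}$ and let $e_1,\dots,e_n$ be the standard basis of $\mathbb{R}^n$. A body in $\mathbb{R}^n$ is a compact subset $T\subset\mathbb{R}^n$. For non-empty $A\subset[n]$, $T_A$ denotes the orthogonal projection of $T$ onto $\mathrm{Span}(A)=\mathrm{span}\{e_i: i\in A\}$, and $|T_A|$ denotes its $|A|$-dimensional volume (Lebesgue measure in $\mathrm{Span}(A)$). Vectors in $\mathbb{R}^{2^n-1}$ have coordinates indexed by the non-empty subsets of $[n]$. A vector $x\in\mathbb{R}^{2^n-1}$ is constructible if there is a body $T\subset\mathbb{R}^n$ (necessarily with $|T_A|>0$ for all non-empty $A$) such that $x_A=\log|T_A|$ for every non-empty $A\subset[n]$. The constructible region is $\psi_n=\{x\in\mathbb{R}^{2^n-1}: x \text{ is constructible}\}$. For a non-empty $Y\subset[n]$ and an integer $k\ge1$, a $k$-uniform cover of $Y$ is a finite collection $Y_1,\dots,Y_l$ of non-empty subsets of $Y$ (not necessarily distinct) such that every element of $Y$ belongs to precisely $k$ of the $Y_i$. The set $BT_n\subset\mathbb{R}^{2^n-1}$ is the set of all $x\in\mathbb{R}^{2^n-1}$ such that for every non-empty $Y\subset[n]$, every $k\ge 1$ and every $k$-uniform cover $Y_1,\dots,Y_l$ of $Y$, one has $\sum_{i=1}^l x_{Y_i}\ge k\,x_Y$. *)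

(* Defs.v *)
(* Written with MathComp and MathComp-Analysis. *)
From HB Require Import structures.
From mathcomp Require Import all_boot all_order all_algebra.
From mathcomp Require Import all_classical all_reals all_analysis.

Set Implicit Arguments.
Unset Strict Implicit.
Unset Printing Implicit Defensive.
Import Order.TTheory GRing.Theory Num.Theory.
Import numFieldNormedType.Exports.

Local Open Scope classical_set_scope.
Local Open Scope ring_scope.

(* Lebesgue measure on R^d, carried by d-tuples since these have the product
   (Borel) sigma-algebra in the library: it is the point mass on R^0, and the
   product of lebesgue_measure with Lebesgue measure on R^d, transported along
   R * R^d ~ R^(d+1). *)
Section lebesgue_tuple_step.
Context {R : realType} (d : nat).
Local Notation T := (measurableTypeR R).

Definition tcons (p : T * d.-tuple T) : d.+1.-tuple T :=
  [the d.+1.-tuple T of p.1 :: p.2].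

Lemma measurable_tcons : measurable_fun [set: T * d.-tuple T] tcons.
Proof.
exact: (measurable_cons (f := @fst T (d.-tuple T)) (g := @snd T (d.-tuple T))).
Qed.

Variable mu : {sigma_finite_measure set (d.-tuple T) -> \bar R}.

Definition lebesgue_step : set (d.+1.-tuple T) -> \bar R :=
  pushforward (@lebesgue_measure R \x mu)%E tcons.

Let lebesgue_step0 : lebesgue_step set0 = 0%E.
Proof. by rewrite /lebesgue_step /pushforward preimage_set0 measure0. Qed.

Let lebesgue_step_ge0 A : (0 <= lebesgue_step A)%E.
Proof. by rewrite /lebesgue_step /pushforward. Qed.

Let lebesgue_step_sigma_additive : semi_sigma_additive lebesgue_step.
Proof.
have mt A : measurable A -> measurable (tcons @^-1` A).
  by move=> mA; rewrite -[X in measurable X]setTI; exact: measurable_tcons.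
move=> F mF tF mUF; rewrite /lebesgue_step /pushforward preimage_bigcup.
apply: measure_semi_sigma_additive.
- by move=> i; exact: mt.
- apply/trivIsetP => i j _ _ ij; rewrite -preimage_setI.
  by move/trivIsetP : tF => ->//; rewrite preimage_set0.
- by rewrite -preimage_bigcup; exact: mt.
Qed.

HB.instance Definition _ := isMeasure.Build _ _ _ lebesgue_step
  lebesgue_step0 lebesgue_step_ge0 lebesgue_step_sigma_additive.

Let lebesgue_step_sigma_finite : sigma_finite setT lebesgue_step.
Proof.
have /sigma_finiteP[F [TF ndF Foo]] := sigma_finiteT (@lebesgue_measure R).
have /sigma_finiteP[G [TG ndG Goo]] := sigma_finiteT mu.
exists (fun k => (@thead d T) @^-1` F k `&`
    (fun t : d.+1.-tuple T => [tuple of behead t]) @^-1` G k).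
  apply/esym/seteqP; split => // t _.
  have [n _ Fn] : (\bigcup_k F k) (thead t) by rewrite -TF.
  have [m _ Gm] : (\bigcup_k G k) [tuple of behead t] by rewrite -TG.
  exists (maxn n m) => //; split => /=.
    by move: Fn; exact/subsetPset/ndF/leq_maxl.
  by move: Gm; exact/subsetPset/ndG/leq_maxr.
move=> k; have [mF Fk] := Foo k; have [mG Gk] := Goo k; split.
  apply: measurableI; rewrite -[X in measurable X]setTI.
    exact: (measurable_tnth ord0).
  exact: measurable_behead.
rewrite /lebesgue_step /pushforward (_ : _ @^-1` _ = F k `*` G k).
  by rewrite product_measure1E// lte_mul_pinfty// ge0_fin_numE.
have tl (p : T * d.-tuple T) : [tuple of behead (tcons p)] = p.2.
  exact/val_inj.
by apply/seteqP; split => p /=; rewrite tl theadE.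
Qed.

HB.instance Definition _ := Measure_isSigmaFinite.Build _ _ _ lebesgue_step
  lebesgue_step_sigma_finite.

End lebesgue_tuple_step.

Fixpoint lebesgue_tuple {R : realType} (d : nat) :
    {sigma_finite_measure set (d.-tuple (measurableTypeR R)) -> \bar R} :=
  match d with
  | 0 => \d_([tuple] : 0.-tuple (measurableTypeR R))
  | d'.+1 => lebesgue_step (lebesgue_tuple d')
  end.

Lemma lebesgue_tuple_box {R : realType} (d : nat)
    (F : 'I_d -> set (measurableTypeR R)) : (forall i, measurable (F i)) ->
  lebesgue_tuple d [set t | forall i, F i (tnth t i)] =
  (\prod_(i < d) lebesgue_measure (F i))%E.
Proof.
elim: d F => [|d IH] F mF.
  rewrite big_ord0 /= diracE mem_set//= => -[]//.
rewrite big_ord_recl -IH; last by move=> i; exact: mF.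
rewrite /= /lebesgue_step /pushforward -product_measure1E //; last first.
  rewrite (_ : [set _ | _] = \bigcap_(i in [set: 'I_d])
      ((@tnth d (measurableTypeR R))^~ i @^-1` F (lift ord0 i))).
    apply: fin_bigcap_measurable => // i _; rewrite -[X in measurable X]setTI.
    exact: measurable_tnth.
  by apply/seteqP; split => t /= + i; [move=> + _; exact|move=> /(_ i I)].
congr product_measure1; apply/seteqP; split => -[x t] /=.
  move=> Fxt; split; first exact: (Fxt ord0).
  by move=> i; have := Fxt (lift ord0 i); rewrite /tcons/= tnthS.
by move=> [Fx Ft] i; case: (unliftP ord0 i) => [j ->|->//]; rewrite tnthS.
Qed.

Section volume.
Context {R : realType} (n : nat).

Definition proj (A : {set 'I_n}) (x : 'rV[R]_n) : 'rV[R]_n :=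
  \row_i (if i \in A then x 0 i else 0).

Definition coords (A : {set 'I_n}) (x : 'rV[R]_n) :
    #|A|.-tuple (measurableTypeR R) :=
  [tuple x 0 (enum_val j) | j < #|A|].

(* |A|-dimensional volume of a subset of Span(A), identified with R^|A| by the
   isometry coords A. *)
Definition volume (A : {set 'I_n}) (S : set 'rV[R]_n) : \bar R :=
  lebesgue_tuple #|A| (coords A @` S).

End volume.

Definition neset (n : nat) := {A : {set 'I_n} | A != finset.set0}.

Lemma card_neset (n : nat) : #|{: neset n}| = (2 ^ n - 1)%N.
Proof.
have := card_powerset [set: 'I_n]%SET.
rewrite cardsT card_ord card_sig => <-.
rewrite (cardsD1 finset.set0) inE finset.sub0set add1n subn1 /=.
by apply: eq_card => A; rewrite !inE finset.subsetT andbT.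
Qed.

(* R^(2^n - 1), by card_neset; coordinates are indexed by the non-empty subsets
   of [n] through enum_rank. *)
Notation logspace R n := 'rV[R]_#|{: neset n}|.

Definition coord {R : realType} {n : nat} (x : logspace R n) (A : neset n) : R :=
  x 0 (enum_rank A).

(* lne is the logarithm extended by lne 0 = -oo, so that all the volumes of a
   witness T are positive. *)
Definition constructible {R : realType} {n : nat} (x : logspace R n) : Prop :=
  exists2 T : set 'rV[R]_n, compact T &
    forall A : neset n, (coord x A)%:E = lne (volume (val A) (proj (val A) @` T)).

Definition constructible_region (R : realType) (n : nat) : set (logspace R n) :=
  [set x | constructible x].

Definition convex_hull {R : realType} {V : lmodType R} (S : set V) : set V :=
  smallest (@convex_set R V) S.

(* Covers are finite families, with repetitions; the order of the list is
   irrelevant. *)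
Definition uniform_cover {n : nat} (k : nat) (Y : neset n) (Ys : seq (neset n)) :
    Prop :=
  (forall Z, Z \in Ys -> val Z \subset val Y) /\
  (forall i, i \in val Y -> count (fun Z : neset n => i \in val Z) Ys = k).

Definition BT (R : realType) (n : nat) : set (logspace R n) :=
  [set x | forall (Y : neset n) (k : nat) (Ys : seq (neset n)),
     (0 < k)%N -> uniform_cover k Y Ys ->
     k%:R * coord x Y <= \sum_(Z <- Ys) coord x Z].

Arguments constructible_region R n : clear implicits.
Arguments BT R n : clear implicits.

(* Main.v *)
Require Import Defs.
From mathcomp Require Import all_boot all_order all_algebra.
From mathcomp Require Import all_classical all_reals all_analysis.
From mathcomp Require Import measurable_realfun.
From mathcomp Require Import lra ring zify.

Set Implicit Arguments.
Unset Strict Implicit.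
Unset Printing Implicit Defensive.
Import Order.TTheory GRing.Theory Num.Theory.
Import numFieldNormedType.Exports.
Local Open Scope classical_set_scope.
Local Open Scope ring_scope.

(* That psi_n lies in the closed convex set BT_n is the Bollobas-Thomason
   inequality |T_Y|^k <= prod |T_(Y_i)|, proved by slicing T along one
   coordinate at a time: the sets Y_i containing that coordinate contribute k
   factors, which Hoelder's inequality integrates, and the others bound their
   own slices.

   Conversely, by linear programming duality every x in BT_n has the form
   x_A = max_Y a_Y(A) with finitely many additive functions a_Y.  Uniform covers
   are integral certificates, so the duality must produce integer multipliers
   although x is real; Fourier-Motzkin elimination does, as the constraint matrix
   is integral.  The union T_t of the boxes with sides exp (t a_Y(i)) then
   satisfies log |(T_t)_A| = t x_A + O(1), so that x is the limit of
   (1/t) log |T_t| + (1 - 1/t) 0, the origin being the image of the unit cube. *)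

Local Notation coord := Defs.coord.

(** * Linear inequalities with integer coefficients *)

Section farkas.
Context {R : realType} {n : nat}.
Local Notation ineq := ('rV[int]_n * R)%type.
Implicit Types (L r : seq ineq) (v w : ineq) (a : 'I_n -> R).

Definition holds a v := \sum_i (v.1 0 i)%:~R * a i <= v.2.

Let mulrn_pair v k : v *+ k = (v.1 *+ k, v.2 *+ k).
Proof.
by elim: k => [|k IH]; [rewrite !mulr0n | rewrite !mulrS IH].
Qed.

(** Repetitions in [r] encode the multipliers, so these are the combinations of members of [L] with
    natural-number coefficients. *)
Definition consequence L v :=
  exists2 r : seq ineq, {subset r <= L} & v = \sum_(w <- r) w.

Lemma consequence_mem L v : v \in L -> consequence L v.
Proof.
move=> vL; exists [:: v]; last by rewrite big_seq1.
by move=> w; rewrite inE => /eqP ->.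
Qed.

Lemma consequenceD L v w :
  consequence L v -> consequence L w -> consequence L (v + w).
Proof.
move=> [r rL ->] [r' r'L ->]; exists (r ++ r'); last by rewrite big_cat.
by move=> u; rewrite mem_cat => /orP[/rL|/r'L].
Qed.

Lemma consequence0 L : consequence L 0.
Proof. by exists [::] => //; rewrite big_nil. Qed.

Lemma consequenceMn L v k : consequence L v -> consequence L (v *+ k).
Proof.
move=> Lv; elim: k => [|k IH]; first exact: consequence0.
by rewrite mulrS; exact: consequenceD.
Qed.

Lemma consequence_trans L L' v : (forall w, w \in L' -> consequence L w) ->
  consequence L' v -> consequence L v.
Proof.
move=> LL' [r rL' ->]; rewrite big_seq.
apply: (big_ind (consequence L)) => [| |w /rL'/LL' //].
  exact: consequence0.
exact: consequenceD.
Qed.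

(** Supplies the value of an eliminated variable from its lower bounds [f] and upper bounds [g].
    Either list may be empty. *)
Lemma between_seq (T : eqType) (lo hi : seq T) (f g : T -> R) :
  (forall x y, x \in lo -> y \in hi -> f x <= g y) ->
  exists z, (forall x, x \in lo -> f x <= z) /\ (forall y, y \in hi -> z <= g y).
Proof.
elim: lo => [_|x lo IH lohi].
  elim: hi => [|y hi [z [_ zhi]]]; first by exists 0.
  exists (Num.min z (g y)); split => // u; rewrite inE => /predU1P[->|/zhi uz].
    by rewrite ge_min lexx orbT.
  by rewrite ge_min uz.
have [x' y x'lo|z [loz zhi]] := IH.
  by apply: lohi; rewrite inE x'lo orbT.
exists (Num.max z (f x)); split => [u|y yhi].
  rewrite inE => /predU1P[->|/loz uz]; first by rewrite le_max lexx orbT.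
  by rewrite le_max uz.
by rewrite ge_max zhi//= lohi// mem_head.
Qed.

(** One Fourier-Motzkin step. Inequalities with opposite signs at [i] are cross-multiplied by the
    absolute values of their coefficients instead of being divided, so all multipliers stay
    integral. *)
Definition eliminate (i : 'I_n) L : seq ineq :=
  [seq v : ineq <- L | v.1 0 i == 0] ++
  [seq p.1 *+ `|p.2.1 ord0 i|%N + p.2 *+ `|p.1.1 ord0 i|%N |
    p : ineq * ineq <- [seq (v, w) | v <- [seq v : ineq <- L | 0 < v.1 0 i],
                       w <- [seq w : ineq <- L | w.1 0 i < 0]]].

Lemma eliminateP i L u : u \in eliminate i L ->
  u.1 0 i = 0 /\ consequence L u.
Proof.
rewrite mem_cat mem_filter => /orP[/andP[/eqP ui uL]|].
  by split=> //; exact: consequence_mem.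
case/mapP => -[v w] /allpairsP[[v' w']] /= [+ + [-> ->]] ->.
rewrite !mem_filter => /andP[vi vL] /andP[wi wL]; split.
  rewrite !mulrn_pair mxE !mulmxnE -[X in X + _]mulr_natr.
  rewrite -[X in _ + X]mulr_natr !natz !abszE ltr0_norm// gtr0_norm//; ring.
by apply: consequenceD; apply: consequenceMn; exact: consequence_mem.
Qed.

Lemma eq_holds a a' v : (forall i, v.1 0 i != 0 -> a i = a' i) ->
  holds a v = holds a' v.
Proof.
move=> aa'; rewrite /holds (eq_bigr (fun i => (v.1 0 i)%:~R * a' i))// => i _.
by have [->|/aa'->//] := eqVneq (v.1 0 i) 0; rewrite !mul0r.
Qed.

(** Once the other variables are fixed, each inequality involving [i] bounds the variable by
    [bnd v], from above or below according to the sign of its coefficient. The combined inequalities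
    say that every lower bound is at most every upper bound. *)
Lemma eliminate_sat i L a : (forall v, v \in eliminate i L -> holds a v) ->
  exists a', forall v, v \in L -> holds a' v.
Proof.
move=> sat.
pose rest v := \sum_(j | j != i) (v.1 0 j)%:~R * a j.
pose bnd v := (v.2 - rest v) / (v.1 0 i)%:~R.
pose hi := [seq v : ineq <- L | 0 < v.1 0 i].
pose lo := [seq v : ineq <- L | v.1 0 i < 0].
have [w v wlo vhi|z [loz zhi]] := @between_seq _ lo hi bnd bnd.
  have /sat : v *+ `|w.1 ord0 i|%N + w *+ `|v.1 ord0 i|%N \in eliminate i L.
    rewrite mem_cat; apply/orP; right; apply/mapP; exists (v, w) => //.
    by apply/allpairsP; exists (v, w).
  move: wlo vhi; rewrite !mem_filter => /andP[wi wL] /andP[vi vL].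
  rewrite !mulrn_pair /holds /=.
  have pE : (`|w.1 ord0 i|%N)%:R = - (w.1 0 i)%:~R :> R.
    by rewrite natr_absz ltr0_norm// rmorphN.
  have qE : (`|v.1 ord0 i|%N)%:R = (v.1 0 i)%:~R :> R.
    by rewrite natr_absz gtr0_norm.
  rewrite -[X in _ <= X + _]mulr_natr -[X in _ <= _ + X]mulr_natr pE qE.
  rewrite (eq_bigr (fun j => (v.1 0 j)%:~R * a j * - (w.1 0 i)%:~R +
      (w.1 0 j)%:~R * a j * (v.1 0 i)%:~R)); last first.
    move=> j _; rewrite !mxE rmorphD /= !mulmxnE !rmorphMn /=.
    rewrite -[X in (X + _) * _]mulr_natr -[X in (_ + X) * _]mulr_natr pE qE.
    ring.
  (* The two terms in [a i] cancel, leaving a comparison of [rest v] and [rest w] with the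
     bounds. *)
  rewrite big_split /= -!mulr_suml (bigD1 i)//= -/(rest v).
  rewrite [X in _ + X * _ <= _](bigD1 i)//= -/(rest w) => h.
  have vi0 : 0 < (v.1 0 i)%:~R :> R by rewrite ltr0z.
  have wi0 : (w.1 0 i)%:~R < 0 :> R by rewrite ltrz0.
  rewrite /bnd ler_ndivrMr// mulrAC ler_pdivrMr//.
  move: h; lra.
exists (fun j => if j == i then z else a j) => v vL.
have sumE : \sum_j (v.1 0 j)%:~R * (if j == i then z else a j) =
    (v.1 0 i)%:~R * z + rest v.
  rewrite (bigD1 i)//= eqxx; congr (_ + _).
  by apply: eq_bigr => j /negbTE ->.
have [vi|vi|vi] := ltgtP (v.1 0 i) 0.
- have /loz : v \in lo by rewrite mem_filter vi.
  by rewrite /holds sumE /bnd ler_ndivrMr ?ltrz0// lerBrDr mulrC.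
- have /zhi : v \in hi by rewrite mem_filter vi.
  by rewrite /holds sumE /bnd ler_pdivlMr ?ltr0z// lerBrDr mulrC.
- have /sat : v \in eliminate i L by rewrite mem_cat mem_filter vi eqxx vL.
  rewrite -(@eq_holds (fun j => if j == i then z else a j))// => j.
  by case: (eqVneq j i) => [->|//]; rewrite vi eqxx.
Qed.

Lemma farkas_int L : (exists a, forall v, v \in L -> holds a v) \/
  (exists2 b, b < 0 & consequence L (0, b)).
Proof.
(* The induction runs over a list [s] containing every variable that still occurs. *)
suff H (s : seq 'I_n) : (forall v i, v \in L -> i \notin s -> v.1 0 i = 0) ->
    (exists a, forall v, v \in L -> holds a v) \/
    (exists2 b, b < 0 & consequence L (0, b)).
  by apply: (H (enum 'I_n)) => v i _; rewrite mem_enum.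
elim: s L => [L L0|i s IH L Ls].
  have L0' v : v \in L -> v.1 = 0 by move=> vL; apply/rowP => i; rewrite mxE L0.
  (* With no variable left each inequality reads [0 <= v.2]: a negative bound is itself the
     certificate, and otherwise any [a] is a solution. *)
  have [/hasP[v vL v0]|/hasPn L_ge0] := boolP (has (fun v : ineq => v.2 < 0) L).
    right; exists v.2 => //; rewrite -(L0' v vL) -surjective_pairing.
    exact: consequence_mem.
  left; exists (fun=> 0) => v vL; rewrite /holds big1 => [|i _].
    by rewrite leNgt L_ge0.
  by rewrite mulr0.
have [v j vL js|[a sat]|[b b0 Lb]] := IH (eliminate i L).
- have [vi Lv] := eliminateP vL.
  have [->//|ji] := eqVneq j i.
  (* A combination of members of [L] has coefficient zero wherever they all do. *)
  case: Lv => r rL ->; rewrite (_ : (\sum_(w <- r) w).1 = \sum_(w <- r) w.1).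
    rewrite summxE big_seq big1// => w /rL wL; apply: Ls => //.
    by rewrite inE negb_or ji.
  exact: (big_morph (fun w : ineq => w.1) (id1 := 0) (op1 := +%R)).
- by left; exact: eliminate_sat sat.
- right; exists b => //; apply: consequence_trans Lb => w.
  by case/eliminateP.
Qed.

End farkas.

(** * Additive minorants of a point of [BT], tight at a given set *)

Section fractional_subadditivity.
Context {R : realType} {n : nat}.

Let indic_row (A : {set 'I_n}) : 'rV[int]_n := \row_i (i \in A)%:R.

Let holds_indic_row (a : 'I_n -> R) (A : {set 'I_n}) b :
  holds a (indic_row A, b) = (\sum_(i in A) a i <= b).
Proof.
rewrite /holds [in RHS]big_mkcond/=; congr (_ <= _); apply: eq_bigr => i _.
by rewrite mxE; case: (i \in A); rewrite ?mul1r ?mul0r.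
Qed.

Let holds_indic_rowN (a : 'I_n -> R) (A : {set 'I_n}) b :
  holds a (- indic_row A, - b) = (b <= \sum_(i in A) a i).
Proof.
rewrite -lerN2 /holds [in RHS]big_mkcond -sumrN/=; congr (_ <= _).
apply: eq_bigr => i _; rewrite !mxE rmorphN /=.
by case: (i \in A); rewrite ?mulN1r ?mul0r ?oppr0 ?mul0r.
Qed.

(** The required conditions on [a] form an integral linear system. A certificate of its
    infeasibility would be a uniform cover of [Y] violating the inequality that defines [BT]. *)
Lemma BT_tight_on (x : logspace R n) (Y : neset n) : BT R n x ->
  exists a : 'I_n -> R,
    (forall A : neset n, val A \subset val Y ->
       \sum_(i in val A) a i <= coord x A) /\
    coord x Y <= \sum_(i in val Y) a i.
Proof.
move=> xBT.
pose below := [seq A : neset n <- enum {: neset n} | val A \subset val Y].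
pose L := (- indic_row (val Y), - coord x Y) ::
  [seq (indic_row (val A), coord x A) | A : neset n <- below].
have [[a aL]|[b b0 [r rL rb]]] := farkas_int L.
  exists a; split=> [A AY|]; last by rewrite -holds_indic_rowN aL ?mem_head.
  rewrite -holds_indic_row aL// inE; apply/orP; right; apply/mapP; exists A => //.
  by rewrite mem_filter AY mem_enum.
(* The certificate [r] is sorted into [m] copies of the reversed inequality for [Y] and a list [Ys]
   of subsets of [Y]. *)
suff [Ys [m [YsY rE]]] : exists Ys m,
    (forall Z : neset n, Z \in Ys -> val Z \subset val Y) /\
    \sum_(w <- r) w =
      (\sum_(Z <- Ys) indic_row (val Z) - indic_row (val Y) *+ m,
       \sum_(Z <- Ys) coord x Z - coord x Y *+ m).
  (* The vanishing of the coefficients of the certificate says that [Ys] is an [m]-uniform cover. *)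
  have cnt i : i \in val Y -> count (fun Z : neset n => i \in val Z) Ys = m.
    move=> iY; move: rb; rewrite rE => -[/(congr1 (fun u : 'rV[int]_n => u 0 i)) + _].
    rewrite !mxE summxE mulmxnE mxE iY (eq_bigr (fun Z : neset n =>
      ((i \in val Z) : nat)%:R)); last by move=> Z _; rewrite mxE.
    rewrite -natr_sum -sum1_count [in X in _ -> X]big_mkcond/=.
    by rewrite (eq_bigr (fun Z : neset n => (i \in val Z) : nat)) //; lia.
  have bE : \sum_(Z <- Ys) coord x Z - coord x Y *+ m = b.
    by move: rb; rewrite rE => -[].
  (* If [m] is zero, no point of [Y] is covered. The members of [Ys] being non-empty, there are
     none, and [b] would be 0. *)
  have [m0|m_gt0] := posnP m.
    suff Ys0 : Ys = [::].
      by move: b0; rewrite -bE m0 Ys0 big_nil mulr0n subr0 ltxx.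
    case: Ys YsY cnt {rE bE} => // Z Ys YsY cnt.
    have /set0Pn[i iZ] := valP Z.
    have /cnt := fintype.subsetP (YsY Z (mem_head _ _)) _ iZ.
    by rewrite /= iZ m0.
  have := xBT Y m Ys m_gt0 (conj YsY cnt).
  by move: b0; rewrite -bE subr_lt0 mulr_natl => /lt_le_trans /[apply]; rewrite ltxx.
elim: r rL {b b0 rb} => [_|w r IH rL].
  by exists [::], 0%N; split => //; rewrite !big_nil !mulr0n !subr0.
have [u ur|Ys [m [YsY rE]]] := IH; first by apply: rL; rewrite inE ur orbT.
rewrite big_cons rE; have := rL w (mem_head _ _).
rewrite inE => /predU1P[->|/mapP[Z]].
  by exists Ys, m.+1; split => //; congr (_, _); rewrite /= mulrS opprD addrCA.
rewrite mem_filter => /andP[ZY _] ->; exists (Z :: Ys), m; split.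
  by move=> Z'; rewrite inE => /predU1P[->//|/YsY].
by congr (_, _); rewrite /= big_cons addrA.
Qed.

(* Making a very negative off Y removes the restriction to subsets of Y. *)
Lemma BT_tight (x : logspace R n) (Y : neset n) : BT R n x ->
  exists a : 'I_n -> R,
    (forall A : neset n, \sum_(i in val A) a i <= coord x A) /\
    coord x Y <= \sum_(i in val Y) a i.
Proof.
move=> /BT_tight_on-/(_ Y) [a [aY Ya]].
(* A single term [- M] outweighs all positive contributions of [a] and still leaves at most
   [coord x A], for every [A] at once. *)
pose M := \sum_(A : neset n) `|coord x A| + \sum_i `|a i|.
have M_ge0 : 0 <= M by rewrite addr_ge0// sumr_ge0.
exists (fun i => if i \in val Y then a i else - M); split; last first.
  by rewrite (eq_bigr a)// => i ->.
move=> A; have [AY|/fintype.subsetPn[i iA iY]] := boolP (val A \subset val Y).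
  rewrite (eq_bigr a) ?aY// => i iA.
  by rewrite (fintype.subsetP AY _ iA).
rewrite (bigD1 i)//= (negbTE iY).
apply: (@le_trans _ _ (- M + \sum_i `|a i|)); last first.
  rewrite /M opprD subrK lerNl; apply: le_trans (ler_norm _) _.
  by rewrite normrN (bigD1 A)//= lerDl sumr_ge0.
rewrite lerD2l [leRHS](bigID (fun j => (j \in val A) && (j != i)))/=.
rewrite ler_wpDr ?sumr_ge0// ler_sum// => j _.
by case: ifP => _; rewrite ?ler_norm// (le_trans _ (normr_ge0 _))// oppr_le0.
Qed.

End fractional_subadditivity.

(** * Volume by iterated slicing *)

Section iterated_volume.
Context {R : realType} {n : nat}.
Local Notation mu := (@lebesgue_measure R).
Implicit Types (S : set 'rV[R]_n) (s : seq 'I_n).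

Definition slice (i : 'I_n) (t : R) S := S `&` [set x : 'rV[R]_n | x 0 i = t].

(** Slices stay in the full space. Coordinates outside [s] are collapsed by the final test for
    non-emptiness, so for compact [S] and duplicate-free [s] this is the volume of the projection of
    [S] to the coordinates in [s]. *)
Fixpoint itvol s S : R :=
  if s is i :: s' then \int[mu]_t itvol s' (slice i t S) else (`[< S !=set0 >])%:R.

Lemma itvol_ge0 s S : 0 <= itvol s S.
Proof.
by elim: s S => [S|i s IH S] /=; [rewrite ler0n|exact: Rintegral_ge0].
Qed.

Lemma slice0 i t : slice i t set0 = set0.
Proof. exact: set0I. Qed.

Lemma itvol_set0 s : itvol s set0 = 0.
Proof.
elim: s => [|i s IH] /=; first by case: asboolP => // -[].
under eq_Rintegral do rewrite slice0 IH.
by rewrite Rintegral_cst// mul0r.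
Qed.

Lemma closed_coord (i : 'I_n) (D : set R) :
  closed D -> closed [set x : 'rV[R]_n | D (x 0 i)].
Proof. by move=> cD; apply: closed_comp => // x _; exact: coord_continuous. Qed.

Lemma compact_slice i t S : compact S -> compact (slice i t S).
Proof.
move=> cS; apply: compact_closedI => //.
by apply: (@closed_coord i [set t]); exact: closed_eq.
Qed.

Lemma compact_coord_bounded S : compact S ->
  exists2 M, 0 <= M & forall x, S x -> forall i, `|x 0 i| <= M.
Proof.
move=> /compact_bounded [M [_ MS]]; exists (`|M| + 1); first by rewrite addr_ge0.
move=> x Sx i; have := MS (`|M| + 1) _ x Sx.
rewrite (le_lt_trans (ler_norm M))// ?ltrDl// => /(_ isT); apply: le_trans.
rewrite [leRHS]/Num.norm/= mx_normrE.
by apply: le_trans (le_bigmax _ _ (ord0, i)).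
Qed.

Lemma compact_closed_rV S : compact S -> closed S.
Proof. by apply: compact_closed; exact: norm_hausdorff. Qed.

(** Cantor's intersection theorem: a cluster point of the filter generated by the [F m] lies in each
    of these closed sets. *)
Lemma compact_bigcap_nonempty (F : (set 'rV[R]_n)^nat) :
  (forall m, compact (F m)) -> {homo F : i j / (i <= j)%N >-> j `<=` i} ->
  (forall m, F m !=set0) -> \bigcap_m F m !=set0.
Proof.
move=> cF decF F0.
have FF : ProperFilter (filter_from [set: nat] F).
  apply: filter_from_proper => //; apply: filter_fromT_filter; first by exists 0%N.
  move=> i j; exists (maxn i j); rewrite subsetI.
  by split; apply: decF; rewrite ?leq_maxl ?leq_maxr.
have [|p [_ pF]] := cF 0%N _ FF; first by exists 0%N.
exists p => m _; apply: (compact_closed_rV (cF m)) => B pB.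
by apply: pF => //; exists m.
Qed.

(** Monotonicity, a bound and continuity from above are proved in one induction: the first and last
    make slice volumes measurable, and the bound provides integrability and a dominating
    function. *)
Definition itvol_regular s :=
  [/\ forall S S', compact S -> compact S' -> S `<=` S' -> itvol s S <= itvol s S',
      forall S (M : R), compact S -> 0 <= M ->
        (forall x, S x -> forall i, `|x 0 i| <= M) -> itvol s S <= (M *+ 2) ^+ size s &
      forall F : (set 'rV[R]_n)^nat, (forall m, compact (F m)) ->
        {homo F : i j / (i <= j)%N >-> j `<=` i} ->
        itvol s (F m) @[m --> \oo] --> itvol s (\bigcap_m F m)].

Lemma sub_slice i t S S' : S `<=` S' -> slice i t S `<=` slice i t S'.
Proof. exact: setSI. Qed.

(* Continuity from above along the thickened slices |x_i - t| <= 1/(m+1) makes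
   the slice volume upper semicontinuous. *)
Lemma measurable_itvol_slice s i S : itvol_regular s -> compact S ->
  measurable_fun setT (fun t => itvol s (slice i t S)).
Proof.
move=> [mono _ cont] cS.
(* Upper semicontinuity of the slice volume is lower semicontinuity of its opposite. *)
suff mN : measurable_fun setT (EFin \o (fun t => - itvol s (slice i t S))).
  rewrite (_ : (fun t => _) = (fun t => - - itvol s (slice i t S))); last first.
    by apply/funext => t; rewrite opprK.
  by apply: measurable_funN; apply/measurable_EFinP.
apply: lower_semicontinuous_measurable => t a; rewrite /= lte_fin ltrNr => ta.
pose F m := S `&` [set x : 'rV[R]_n | `[t - m.+1%:R^-1, t + m.+1%:R^-1]%classic (x 0 i)].
have cF m : compact (F m).
  by apply: compact_closedI => //; apply: closed_coord; exact: itv_closed.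
have inv_le j k : (j <= k)%N -> k.+1%:R^-1 <= j.+1%:R^-1 :> R.
  by move=> jk; rewrite lef_pV2 ?posrE// ler_nat.
have decF : {homo F : j k / (j <= k)%N >-> k `<=` j}.
  move=> j k /inv_le jk; apply: setIS => x /=; rewrite !in_itv/= => /andP[h1 h2].
  by rewrite (le_trans _ h1) ?(le_trans h2)// ?lerD2l ?lerN2.
have capF : \bigcap_m F m = slice i t S.
  apply/seteqP; split => [x xF|x [Sx xt] m _]; last first.
    by split => //=; rewrite xt in_itv/= gerBl lerDl invr_ge0 ler0n.
  split; first by have [] := xF 0%N I.
  rewrite /=; apply/eqP; rewrite -subr_eq0 -normr_le0; apply/ler_addgt0Pr => e e0.
  rewrite add0r; have [_ /=] := xF (Num.truncn e^-1) I.
  rewrite in_itv/= => xt.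
  apply: (@le_trans _ _ (Num.truncn e^-1).+1%:R^-1).
    by rewrite ler_distl.
  rewrite -[leRHS]invrK lef_pV2 ?posrE ?invr_gt0//.
  by apply/ltW; rewrite truncnS_gt// invr_ge0 ltW.
(* Some thickened slice [F m] has volume below [- a], and it contains all slices at distance less
   than 1/(m+1) from [t]. *)
have := cont F cF decF; rewrite capF => /cvgr_lt /(_ _ ta) [m _ /(_ m (leqnn m)) /= Fm].
exists (ball t m.+1%:R^-1) => [|u].
  by apply: nbhsx_ballx; rewrite invr_gt0.
rewrite /ball/= => tu; rewrite /= lte_fin ltrNr; apply: le_lt_trans Fm.
apply: mono => //; first exact: compact_slice.
apply: setIS => x /= ->; rewrite in_itv/=.
by move: tu; rewrite ltr_distlC => /andP[/ltW -> /ltW ->].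
Qed.

Lemma itvol_slice_le s i S (M t : R) : itvol_regular s -> compact S -> 0 <= M ->
  (forall x, S x -> forall j, `|x 0 j| <= M) ->
  itvol s (slice i t S) <= (M *+ 2) ^+ size s * \1_`[- M, M] t.
Proof.
move=> [_ bnd _] cS M0 SM.
have [tM|tM] := boolP (t \in `[- M, M]%classic).
  rewrite indicE tM mulr1; apply: bnd => //; first exact: compact_slice.
  by move=> x [/SM].
rewrite (_ : slice i t S = set0).
  by rewrite itvol_set0 mulr_ge0// exprn_ge0// mulrn_wge0.
apply/seteqP; split => // x [/SM/(_ i)] + /= xt.
rewrite xt => tM'; move/negP : tM; apply; rewrite inE/= in_itv/=.
by rewrite -ler_norml.
Qed.

Lemma integrable_box s (M : R) :
  mu.-integrable setT (fun t => ((M *+ 2) ^+ size s * \1_`[- M, M] t)%:E).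
Proof.
under eq_fun do rewrite EFinM.
by apply: integrableZl => //; exact: integrable_indic_itv.
Qed.

Lemma Rintegral_box s (M : R) : 0 <= M ->
  \int[mu]_t ((M *+ 2) ^+ size s * \1_`[- M, M] t) = (M *+ 2) ^+ (size s).+1.
Proof.
move=> M0; have muE : mu `[- M, M]%classic = (M *+ 2)%:E.
  rewrite lebesgue_measure_itv/= lte_fin; case: (ltP (- M) M) => [_|MM].
    by rewrite -EFinB opprK.
  by have -> : M = 0 by [lra]; rewrite mul0rn.
rewrite RintegralZl//; last exact: integrable_indic_itv.
rewrite /Rintegral integral_indic// setIT exprSr; congr (_ * _).
exact: (congr1 fine muE).
Qed.

Lemma integrable_itvol_slice s i S : itvol_regular s -> compact S ->
  mu.-integrable setT (fun t => (itvol s (slice i t S))%:E).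
Proof.
move=> regs cS; have [M M0 SM] := compact_coord_bounded cS.
apply: le_integrable (integrable_box s M) => //.
  by apply/measurable_EFinP; exact: measurable_itvol_slice.
move=> t _ /=; rewrite lee_fin ger0_norm ?itvol_ge0//.
by rewrite (le_trans (itvol_slice_le i t regs cS M0 SM))// ler_norm.
Qed.

Lemma itvol_regular_nil : itvol_regular [::].
Proof.
split=> [S S' _ _ SS'|S M _ _ _|F cF decF] /=.
- rewrite ler_nat; case: asboolP => // -[x /SS' S'x].
  by case: asboolP => // -[]; exists x.
- by rewrite expr0 lern1 leq_b1.
- have [F0|] := pselect (forall m, F m !=set0).
    rewrite (asboolT (compact_bigcap_nonempty cF decF F0)).
    under eq_fun do rewrite (asboolT (F0 _)).
    exact: cvg_cst.
  move=> /existsNP[m /set0P/negP/negPn/eqP Fm].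
  have F0 k : (m <= k)%N -> F k = set0.
    by move=> /decF; rewrite Fm subset0.
  rewrite (_ : \bigcap_m F m = set0); last first.
    by rewrite -subset0 => x /(_ m I); rewrite Fm.
  apply: cvg_near_cst; exists m => // k /= /F0 ->; exact/eqP.
Qed.

(** Monotonicity and the bound are integrated over the slices. Continuity from above is dominated
    convergence, the dominating function coming from a cube that contains [F 0]. *)
Lemma itvol_regular_cons i s : itvol_regular s -> itvol_regular (i :: s).
Proof.
move=> regs; have [mono _ cont] := regs.
have intg S : compact S -> mu.-integrable setT
    (EFin \o (fun t => itvol s (slice i t S))).
  exact: integrable_itvol_slice.
split=> [S S' cS cS' SS'|S M cS M0 SM|F cF decF] /=.
- apply: le_Rintegral => //; [exact: intg|exact: intg|move=> t _].
  by apply: mono; [exact: compact_slice..|exact: sub_slice].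
- rewrite -Rintegral_box//; apply: le_Rintegral => //; first exact: intg.
    exact: integrable_box.
  by move=> t _; exact: itvol_slice_le.
- have [M M0 F0M] := compact_coord_bounded (cF 0%N).
  have capF t : slice i t (\bigcap_m F m) = \bigcap_m slice i t (F m).
    apply/seteqP; split=> [x [xF xt] m _|x xF]; first by split => //; exact: xF.
    by split=> [m _|]; [have [] := xF m I|have [] := xF 0%N I].
  have ccap : compact (\bigcap_m F m).
    apply: (subclosed_compact _ (cF 0%N)); last exact: bigcap_inf.
    apply: closed_bigI => m _; exact: compact_closed_rV.
  have [] := @dominated_convergence _ _ _ mu setT measurableT
    (fun m t => (itvol s (slice i t (F m)))%:E)
    (fun t => (itvol s (slice i t (\bigcap_m F m)))%:E)
    (fun t => ((M *+ 2) ^+ size s * \1_`[- M, M] t)%:E).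
  + by move=> m; apply/measurable_EFinP; exact: measurable_itvol_slice.
  + by apply/measurable_EFinP; exact: measurable_itvol_slice.
  + apply: aeW => t _; rewrite capF; apply/fine_cvgP; split.
      exact: nearW.
    apply: (cont (fun m => slice i t (F m))) => [m|j k jk].
      exact: compact_slice.
    exact/sub_slice/decF.
  + exact: integrable_box.
  + apply: aeW => t m _; rewrite /= lee_fin ger0_norm ?itvol_ge0//.
    apply: itvol_slice_le => // x Fx; apply: F0M; exact: (decF 0%N m).
  move=> /(integrable_fin_num measurableT) fin _ cv; apply: fine_cvg.
  by rewrite fineK.
Qed.

Lemma itvolP s : itvol_regular s.
Proof.
by elim: s => [|i s]; [exact: itvol_regular_nil|exact: itvol_regular_cons].
Qed.

End iterated_volume.

(** * Hoelder's inequality for several factors *)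

Section generalized_holder.
Context d (T : measurableType d) (R : realType).
Variable mu : {measure set T -> \bar R}.

Lemma Rintegral_lincomb (I : Type) (r : seq I) (a : I -> R) (f : I -> T -> R) :
  (forall i, mu.-integrable setT (EFin \o f i)) ->
  mu.-integrable setT (EFin \o (fun t => \sum_(i <- r) a i * f i t)) /\
  \int[mu]_t (\sum_(i <- r) a i * f i t) = \sum_(i <- r) a i * \int[mu]_t f i t.
Proof.
move=> intf; elim: r => [|i r [intr IH]].
  rewrite (_ : (fun t => _) = cst 0); last first.
    by apply/funext => t; rewrite big_nil.
  split; last by rewrite big_nil /Rintegral integral0.
  exact: integrable0.
have inti : mu.-integrable setT (EFin \o (fun t => a i * f i t)).
  rewrite (_ : _ \o _ = (fun t => (a i)%:E * (f i t)%:E)%E) //.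
  by apply: integrableZl => //; exact: intf.
rewrite (_ : (fun t => _) =
    (fun t => a i * f i t + \sum_(j <- r) a j * f j t)); last first.
  by apply/funext => t; rewrite big_cons.
split.
  rewrite (_ : _ \o _ = ((EFin \o (fun t => (a i * f i t)%R)) \+
    (EFin \o (fun t => (\sum_(j <- r) a j * f j t)%R)))%E)//.
  exact: integrableD.
by rewrite RintegralD// IH RintegralZl// big_cons.
Qed.

(** A vanishing integral cannot be normalised, so the bound is first proved with arbitrary positive
    [c i] above the integrals, and the excess is then sent to 0. *)
Lemma generalized_holder (k : nat) (g : T -> R) (f : 'I_k -> T -> R) (C : R) :
  (0 < k)%N -> 0 <= C -> (forall t, 0 <= g t) -> (forall i t, 0 <= f i t) ->
  mu.-integrable setT (EFin \o g) ->
  (forall i, mu.-integrable setT (EFin \o f i)) ->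
  (forall t, g t ^+ k <= C * \prod_i f i t) ->
  (\int[mu]_t g t) ^+ k <= C * \prod_i \int[mu]_t f i t.
Proof.
move=> k0 C0 g0 f0 intg intf gf.
have kR0 : 0 < k%:R :> R by rewrite ltr0n.
have If0 i : 0 <= \int[mu]_t f i t by exact: Rintegral_ge0.
(* AM-GM applied to the f_i / c_i, whose integrals are at most 1 *)
have bound (c : 'I_k -> R) : (forall i, 0 < c i) ->
    (forall i, \int[mu]_t f i t <= c i) -> (\int[mu]_t g t) ^+ k <= C * \prod_i c i.
  move=> c0 fc; set D := C * _.
  have D0 : 0 <= D by rewrite mulr_ge0// prodr_ge0// => i _; exact: ltW.
  pose r := D `^ k%:R^-1.
  have rk : r ^+ k = D.
    by rewrite -powR_mulrn ?powR_ge0// -powRrM mulVf ?gt_eqF// powRr1.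
  (* With these weights AM-GM reads [g t <= \sum_i a i * f i t], and each summand on the right
     integrates to at most [r / k%:R]. *)
  pose a i := r / k%:R / c i.
  have a0 i : 0 <= a i by rewrite !mulr_ge0 ?invr_ge0 ?powR_ge0// ltW.
  have [inth inthE] := Rintegral_lincomb (index_enum 'I_k) a intf.
  have gh t : g t <= \sum_i a i * f i t.
    have fc0 i : 0 <= f i t / c i by rewrite divr_ge0// ltW.
    have := leif_AGM (A := 'I_k) (fun i _ => fc0 i) => -[agm _].
    rewrite -(ler_pXn2r k0) ?nnegrE ?sumr_ge0// => [|i _]; last by rewrite mulr_ge0.
    rewrite (_ : \sum_i _ = r * ((\sum_i f i t / c i) / k%:R)); last first.
      rewrite mulr_suml mulr_sumr; apply: eq_bigr => i _; rewrite /a; ring.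
    rewrite exprMn rk; apply: le_trans (gf t) _.
    rewrite (_ : C * _ = D * \prod_(i in 'I_k) (f i t / c i)); last first.
      rewrite /D -mulrA -big_split/=; congr (_ * _); apply: eq_bigr => i _.
      by rewrite mulrCA divff ?mulr1// gt_eqF.
    by move: agm; rewrite card_ord => agm; exact: ler_wpM2l.
  have Ig_le : \int[mu]_t g t <= r.
    apply: le_trans (_ : \int[mu]_t (\sum_i a i * f i t) <= _).
      by apply: le_Rintegral => // t _; exact: gh.
    rewrite inthE (_ : r = \sum_(i < k) r / k%:R); last first.
      by rewrite sumr_const card_ord -[RHS]mulr_natr divfK// gt_eqF.
    apply: ler_sum => i _; rewrite /a -mulrA ler_piMr//.
      by rewrite mulr_ge0 ?invr_ge0 ?powR_ge0 ?ler0n.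
    by rewrite mulrC ler_pdivrMr// mul1r.
  rewrite -rk ler_pXn2r// nnegrE ?powR_ge0//; exact: Rintegral_ge0.
(* The bound for [c i] equal to the integral plus [x] is a polynomial in [x], hence continuous at
   0. *)
pose p : {poly R} := C%:P * \prod_i ((\int[mu]_t f i t)%:P + 'X).
have pE x : p.[x] = C * \prod_i (\int[mu]_t f i t + x).
  rewrite hornerM hornerC horner_prod; congr (_ * _); apply: eq_bigr => i _.
  by rewrite hornerD hornerC hornerX.
have -> : C * \prod_i \int[mu]_t f i t = p.[0].
  by rewrite pE; congr (_ * _); apply: eq_bigr => i _; rewrite addr0.
have p_cvg : p.[x] @[x --> 0^'+] --> p.[0].
  by apply: cvg_at_right_filter; exact: continuous_horner.
apply: (cvgr_to_ge p_cvg); near=> x; rewrite pE; apply: bound => i.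
  by rewrite ltr_wpDl.
by rewrite lerDl ltW.
Unshelve. all: by end_near. Qed.

End generalized_holder.

(** * The Bollobas-Thomason inequality *)

Section bollobas_thomason.
Context {R : realType} {n : nat}.
Local Notation mu := (@lebesgue_measure R).
Implicit Types (S : set 'rV[R]_n) (s : seq 'I_n).

Lemma itvol_slice_sub s i t S : compact S -> itvol s (slice i t S) <= itvol s S.
Proof.
have [mono _ _] := @itvolP R n s; move=> cS; apply: mono => //.
  exact: compact_slice.
exact: subIsetl.
Qed.

(** Cover members are predicates so that the same list covers the tail of [s] in the induction, even
    where a member becomes empty on that tail. *)
Lemma itvol_uniform_cover (k : nat) s (Ps : seq (pred 'I_n)) S :
  (0 < k)%N -> compact S ->
  {in s, forall i, count (fun P : pred 'I_n => P i) Ps = k} ->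
  itvol s S ^+ k <= \prod_(P <- Ps) itvol [seq j <- s | P j] S.
Proof.
move=> k0; elim: s S => [|i s IH] S cS cover.
  rewrite /=; case: asboolP => [_|_]; first by rewrite expr1n big1.
  by rewrite expr0n gtn_eqF// prodr_ge0.
pose f (P : pred 'I_n) t := itvol [seq j <- s | P j] (slice i t S).
(* Members missing [i] form a factor independent of [t]; exactly [k] members, those in [Qs], remain
   under integrals. *)
pose C := \prod_(P <- Ps | ~~ P i) itvol [seq j <- s | P j] S.
pose Qs := [seq P : pred 'I_n <- Ps | P i].
have sQs : size Qs = k by rewrite size_filter cover ?mem_head.
have intf s' : mu.-integrable setT (EFin \o (fun t => itvol s' (slice i t S))).
  by apply: integrable_itvol_slice => //; exact: itvolP.
have -> : \prod_(P <- Ps) itvol [seq j <- i :: s | P j] S =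
    C * \prod_(j < k) \int[mu]_t f (nth xpredT Qs j) t.
  rewrite (bigID (fun P : pred 'I_n => P i))/= mulrC; congr (_ * _).
    by apply: eq_bigr => P /negbTE ->.
  rewrite -[in RHS]sQs.
  rewrite -(big_mkord xpredT (fun j => \int[mu]_t f (nth xpredT Qs j) t)).
  rewrite -(big_nth xpredT xpredT (fun P => \int[mu]_t f P t)) big_filter.
  by apply: eq_bigr => P ->.
apply: (@generalized_holder _ _ _ mu k (fun t => itvol s (slice i t S))) => //.
- by apply: prodr_ge0 => P _; exact: itvol_ge0.
- by move=> t; exact: itvol_ge0.
- by move=> j t; exact: itvol_ge0.
- by move=> j; exact: intf.
move=> t; apply: le_trans (IH _ (compact_slice cS) _) _.
  by move=> j js; apply: cover; rewrite inE js orbT.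
rewrite (bigID (fun P : pred 'I_n => P i))/= mulrC ler_pM//.
- by apply: prodr_ge0 => P _; exact: itvol_ge0.
- by apply: prodr_ge0 => P _; exact: itvol_ge0.
- apply: ler_prod => P _; rewrite itvol_ge0/=; exact: itvol_slice_sub.
- rewrite -[in leRHS]sQs.
  rewrite -(big_mkord xpredT (fun j => f (nth xpredT Qs j) t)).
  by rewrite -(big_nth xpredT xpredT (fun P => f P t)) big_filter.
Qed.

(** The section at [t] of the image of [S] is the image of the slice at [t] under the remaining
    coordinates, so both recursions agree. A separate [d] is used because [#|A|] and [size (enum A)]
    are equal only by a lemma. *)
Lemma lebesgue_tuple_itvol d s (c : 'rV[R]_n -> d.-tuple (measurableTypeR R)) S :
  d = size s -> (forall x, c x = [seq x 0 i | i <- s] :> seq R) -> compact S ->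
  lebesgue_tuple d (c @` S) = (itvol s S)%:E.
Proof.
move=> ds; rewrite ds in c * => {d ds}.
elim: s c S => [|i s IH] c S cE cS /=.
  rewrite diracE; case: asboolP => [[x Sx]|S0].
    rewrite mem_set//; exists x => //; exact/val_inj/cE.
  by rewrite memNset// => -[x Sx _]; apply: S0; exists x.
have intf : mu.-integrable setT (EFin \o (fun t => itvol s (slice i t S))).
  by apply: integrable_itvol_slice => //; exact: itvolP.
rewrite /Rintegral fineK; last exact: integrable_fin_num.
rewrite /lebesgue_step /pushforward /product_measure1.
apply: eq_integral => t _ /=.
pose c' (x : 'rV[R]_n) : (size s).-tuple (measurableTypeR R) :=
  map_tuple (fun i => x 0 i) (in_tuple s).
rewrite -(IH c')//; last exact: compact_slice.
congr (lebesgue_tuple _ _).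
apply/seteqP; split => [u|u [x [Sx /= xt] <-]].
  rewrite xsectionP/= => -[x Sx cx].
  have := cE x; rewrite cx /= => -[tE uE].
  by exists x; [split => //=|apply/val_inj; rewrite /= uE].
rewrite xsectionP/=; exists x => //; apply/val_inj.
by rewrite /= cE/= -xt.
Qed.

Lemma volume_itvol (A : {set 'I_n}) S : compact S ->
  volume A S = (itvol (enum A) S)%:E.
Proof.
move=> cS; apply: lebesgue_tuple_itvol => //; first exact: cardE.
move=> x; apply: (@eq_from_nth _ 0) => [|j]; first by rewrite size_tuple size_map cardE.
rewrite size_tuple => jA; have jA' : (j < size (enum A))%N by rewrite -cardE.
have /set0Pn[i0 _] : A != finset.set0 by rewrite -card_gt0 (leq_trans _ jA).
rewrite (nth_map i0)//; transitivity (tnth (coords A x) (Ordinal jA)).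
  by rewrite (tnth_nth 0).
by rewrite tnth_mktuple (enum_val_nth i0).
Qed.

Lemma volume_proj (A : {set 'I_n}) S : volume A (Defs.proj A @` S) = volume A S.
Proof.
rewrite /volume image_comp; congr (lebesgue_tuple _ _).
apply: eq_imagel => x _ /=; apply: eq_from_tnth => j.
by rewrite !tnth_mktuple mxE enum_valP.
Qed.

Lemma itvol_uniform_cover_neset (k : nat) (Y : neset n) (Ys : seq (neset n)) S :
  (0 < k)%N -> uniform_cover k Y Ys -> compact S ->
  itvol (enum (val Y)) S ^+ k <= \prod_(Z <- Ys) itvol (enum (val Z)) S.
Proof.
move=> k0 [YsY cover] cS.
pose Ps := [seq (fun i => i \in val Z) : pred 'I_n | Z : neset n <- Ys].
have := @itvol_uniform_cover k (enum (val Y)) Ps S k0 cS.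
rewrite big_map => H; apply: le_trans (H _) _.
  by move=> i; rewrite mem_enum => /cover <-; rewrite count_map.
rewrite [leLHS]big_seq_cond [leRHS]big_seq_cond le_eqVlt; apply/orP; left; apply/eqP.
apply: eq_bigr => Z /andP[/YsY ZY _]; congr itvol.
rewrite {1}/enum_mem -filter_predI; apply: eq_filter => i /=.
by rewrite andb_idr// => /(fintype.subsetP ZY).
Qed.

End bollobas_thomason.

(** * Unions of boxes and the constructible region *)

Section boxes.
Context {R : realType} {n : nat}.
Implicit Types (a : 'I_n -> R) (A : {set 'I_n}).

Definition exp_box a : set 'rV[R]_n :=
  [set x | forall i, x ord0 i \in `[0, expR (a i)]].

Lemma compact_exp_box a : compact (exp_box a).
Proof.
apply: (@rV_compact R n (fun i => `[0, expR (a i)]%classic)) => i.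
exact: segment_compact.
Qed.

Let side A a (j : 'I_#|A|) : set (measurableTypeR R) :=
  `[0, expR (a (enum_val j))]%classic.

Lemma coords_exp_box A a : coords A @` exp_box a =
  [set t | forall j, side a j (tnth t j)].
Proof.
apply/seteqP; split => [_ [x xa <-] j|t tA].
  by rewrite tnth_mktuple; exact: xa.
(* Coordinates outside [A] are filled with 0, which lies in every side of the box. *)
pose x : 'rV[R]_n := \row_i
  if [pick j : 'I_#|A| | enum_val j == i] is Some j then tnth t j else 0.
exists x => [i|].
  rewrite mxE; case: pickP => [j /eqP <-|_]; first exact: tA.
  by rewrite in_itv/= lexx expR_ge0.
apply: eq_from_tnth => j; rewrite tnth_mktuple mxE.
by case: pickP => [j' /eqP/enum_val_inj -> //|/(_ j)]; rewrite eqxx.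
Qed.

Lemma measurable_coords_exp_box A a : measurable (coords A @` exp_box a).
Proof.
rewrite coords_exp_box (_ : [set _ | _] = \bigcap_(j in [set: 'I_#|A|])
    ((@tnth #|A| (measurableTypeR R))^~ j @^-1` side a j)).
  apply: fin_bigcap_measurable => // j _; rewrite -[X in measurable X]setTI.
  by apply: measurable_tnth => //; exact: measurable_itv.
by apply/seteqP; split => t /= + i; [move=> + _; exact|move=> /(_ i I)].
Qed.

Lemma volume_exp_box A a :
  volume A (exp_box a) = (expR (\sum_(i in A) a i))%:E.
Proof.
rewrite /volume coords_exp_box lebesgue_tuple_box => [|j]; last exact: measurable_itv.
rewrite (eq_bigr (fun j => (expR (a (enum_val j)))%:E)) => [|j _]; last first.
  by rewrite lebesgue_measure_itv/= lte_fin expR_gt0 sube0.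
by rewrite prodEFin -expR_sum [in RHS]big_enum_val.
Qed.

Definition exp_boxes (J : finType) (b : J -> 'I_n -> R) :=
  \big[setU/set0]_j exp_box (b j).

Lemma compact_exp_boxes (J : finType) (b : J -> 'I_n -> R) :
  compact (exp_boxes b).
Proof.
apply: (big_ind (@compact _)) => [||j _]; first exact: compact0.
  exact: compactU.
exact: compact_exp_box.
Qed.

Let measurable_coords_bigsetU A (J : finType) (b : J -> 'I_n -> R) (r : seq J) :
  measurable (coords A @` \big[setU/set0]_(j <- r) exp_box (b j)).
Proof.
elim: r => [|j r IH]; first by rewrite big_nil image_set0.
rewrite big_cons image_setU; apply: measurableU => //.
exact: measurable_coords_exp_box.
Qed.

Lemma volume_exp_boxes_le A (J : finType) (b : J -> 'I_n -> R) :
  (volume A (exp_boxes b) <= (\sum_j expR (\sum_(i in A) b j i))%:E)%E.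
Proof.
rewrite /exp_boxes; elim: (index_enum J) => [|j r IH].
  by rewrite !big_nil /volume image_set0 measure0.
rewrite !big_cons /volume image_setU; apply: le_trans (measureU2 _ _ _) _.
- exact: measurable_coords_exp_box.
- exact: measurable_coords_bigsetU.
- by rewrite EFinD leeD// -volume_exp_box.
Qed.

Lemma volume_exp_boxes_ge A (J : finType) (b : J -> 'I_n -> R) (j : J) :
  ((expR (\sum_(i in A) b j i))%:E <= volume A (exp_boxes b))%E.
Proof.
rewrite -volume_exp_box; apply: le_measure; rewrite ?inE.
- exact: measurable_coords_exp_box.
- exact: measurable_coords_bigsetU.
- by apply: image_subset; rewrite /exp_boxes (bigD1 j)//=; exact: subsetUl.
Qed.

End boxes.

(** * The closed convex hull of the constructible region *)

Section constructible_region.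
Context {R : realType} {n : nat}.
Implicit Types (x y : logspace R n) (A : neset n).

Lemma constructible_BT x : constructible x -> BT R n x.
Proof.
move=> [T cT xT] Y k Ys k0 cover.
have expx A : itvol (enum (val A)) T = expR (coord x A).
  have := xT A; rewrite volume_proj volume_itvol//.
  (* A zero volume would have logarithm -oo, which is not a real coordinate. *)
  have := itvol_ge0 (enum (val A)) T; rewrite le_eqVlt => /predU1P[<-|v0].
    by rewrite le0_lneNy.
  by rewrite lne_EFin// => -[->]; rewrite lnK.
have := itvol_uniform_cover_neset k0 cover cT.
rewrite expx -expRM_natl; under eq_bigr do rewrite expx.
by rewrite -expR_sum ler_expR.
Qed.

Lemma convex_BT : convex_set (BT R n : set (convex_lmodType _)).
Proof.
move=> x y l /set_mem xBT /set_mem yBT; apply/mem_set => Y k Ys k0 cover.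
have cE A : coord (conv l (x : convex_lmodType (logspace R n)) y) A =
    l%:inum * coord x A + (1 - l%:inum) * coord y A by rewrite /Defs.coord !mxE.
rewrite cE; under eq_bigr do rewrite cE.
rewrite big_split/= -!mulr_sumr mulrDr !(mulrCA k%:R).
by rewrite lerD// ler_wpM2l ?subr_ge0 ?le1 ?ge0//; [exact: xBT|exact: yBT].
Qed.

(** An intersection of closed half-spaces, one for each uniform cover. *)
Lemma closed_BT : closed (BT R n).
Proof.
have -> : BT R n = \bigcap_(p in [set p : neset n * nat * seq (neset n) |
    (0 < p.1.2)%N /\ uniform_cover p.1.2 p.1.1 p.2])
  [set x | 0 <= \sum_(Z <- p.2) coord x Z - p.1.2%:R * coord x p.1.1].
  apply/seteqP; split=> [x xBT [[Y k] Ys] [/= k0 cover]|x xBT Y k Ys k0 cover].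
    by rewrite subr_ge0; exact: xBT.
  by rewrite -subr_ge0; exact: (xBT (Y, k, Ys)).
apply: closed_bigI => -[[Y k] Ys] _ /=.
have ccoord A : continuous (fun x => coord x A) by exact: coord_continuous.
have csum : continuous (fun x => \sum_(Z <- Ys) coord x Z).
  by apply: continuous_big => [|Z _]; [exact: add_continuous|exact: ccoord].
pose f (x : logspace R n) : R := \sum_(Z <- Ys) coord x Z - k%:R * coord x Y.
have cf : continuous f.
  move=> x; have Fx : Filter (nbhs x) := nbhs_filter x.
  exact: cvgB (csum x) (cvgM (cvg_cst (k%:R : R)) (ccoord Y x)).
exact: (@closed_comp _ R f [set r | 0 <= r] (fun x _ => cf x) (@closed_ge _ 0)).
Qed.

Lemma convex_hull_sub (V : lmodType R) (S C : set V) :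
  S `<=` C -> convex_set (C : set (convex_lmodType V)) -> convex_hull S `<=` C.
Proof. by move=> SC cC v; apply. Qed.

Lemma constructible0 : constructible (0 : logspace R n).
Proof.
exists (exp_box (fun=> 0)); first exact: compact_exp_box.
by move=> A; rewrite volume_proj volume_exp_box big1// expR0 lne1 /Defs.coord mxE.
Qed.

(** Every box of the union projects to volume at most [expR (t * coord x A)], and the box chosen for
    [A] itself attains it. The error thus comes from the number of boxes alone and is uniform in
    [t]. *)
Lemma constructible_near_dilate x (t : R) : BT R n x -> 0 <= t ->
  exists2 y, constructible y &
    forall A, t * coord x A <= coord y A <= t * coord x A + ln #|{: neset n}|%:R.
Proof.
move=> xBT t0; have [a aP] := choice (fun Y => BT_tight Y xBT).
pose b Y i := t * a Y i; pose T := exp_boxes b.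
have vol A : exists2 v : R, volume (val A) T = v%:E &
    expR (t * coord x A) <= v <= #|{: neset n}|%:R * expR (t * coord x A).
  have := volume_exp_boxes_ge (val A) b A.
  have := volume_exp_boxes_le (val A) b.
  rewrite -/T volume_itvol ?lee_fin; last exact: compact_exp_boxes.
  move=> hi lo; exists (itvol (enum (val A)) T) => //; apply/andP; split.
    apply: le_trans lo; rewrite ler_expR -mulr_sumr ler_wpM2l//.
    by have [_] := aP A.
  apply: (le_trans hi); rewrite mulr_natl -sumr_const; apply: ler_sum => Y _.
  rewrite ler_expR -mulr_sumr ler_wpM2l//.
  by have [+ _] := aP Y; exact.
pose y : logspace R n := \row_j ln (fine (volume (val (enum_val j)) T)).
have yE A : coord y A = ln (fine (volume (val A) T)).
  by rewrite /Defs.coord mxE enum_rankK.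
exists y; first exists T; first exact: compact_exp_boxes.
  move=> A; rewrite yE volume_proj; have [v -> /andP[v_lo _]] := vol A.
  by rewrite lne_EFin// (lt_le_trans (expR_gt0 _) v_lo).
move=> A; rewrite yE; have [v -> /andP[v_lo v_hi]] := vol A.
have v0 : 0 < v by exact: lt_le_trans (expR_gt0 _) v_lo.
have N0 : 0 < #|{: neset n}|%:R :> R.
  by rewrite ltr0n; apply/card_gt0P; exists A.
rewrite /= -ler_expR lnK ?posrE// v_lo/=.
by rewrite -ler_expR lnK ?posrE// expRD lnK ?posrE// mulrC.
Qed.

Lemma BT_sub_closure : BT R n `<=` closure (convex_hull (constructible_region R n)).
Proof.
move=> x xBT B /nbhs_ballP[e /= e0 xB].
set K := ln (#|{: neset n}|%:R : R).
(* Scaling back by the dilation factor [m.+1] brings the uniform error [K] below [e]. *)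
pose m := Num.truncn (`|K| / e).
have mK : `|K| / m.+1%:R < e.
  by rewrite ltr_pdivrMr// mulrC -ltr_pdivrMr// truncnS_gt.
have m0 : 0 <= m.+1%:R^-1 :> R by rewrite invr_ge0.
have m1 : m.+1%:R^-1 <= 1 :> R by rewrite invf_le1// ler1n.
have [y cy yP] := constructible_near_dilate xBT (ler0n R m.+1).
(* This is [y] divided by [m.+1], written as a convex combination of the constructible points [y]
   and 0. *)
pose p : logspace R n := conv (@Itv01 R _ m0 m1) (y : convex_lmodType (logspace R n)) 0.
exists p; split.
  move=> C [cC subC]; apply/set_mem/cC; apply/mem_set/subC => //.
  exact: constructible0.
apply: xB; split => // i j; rewrite ord1 /ball/= /p !mxE mulr0 addr0.
have := yP (enum_val j); rewrite /Defs.coord enum_valK => /andP[y_lo y_hi].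
apply: le_lt_trans mK; have M0 : 0 < m.+1%:R :> R by rewrite ltr0n.
set X := x ord0 j in y_lo y_hi *; set z := y ord0 j in y_lo y_hi *.
rewrite -{1}(mulKf (lt0r_neq0 M0) X) -mulrBr normrM gtr0_norm ?invr_gt0//.
rewrite mulrC ler_pM2r ?invr_gt0// distrC ger0_norm ?subr_ge0//.
by rewrite lerBlDl (le_trans y_hi)// lerD2l ler_norm.
Qed.

End constructible_region.

Theorem theorem4 (R : realType) (n : nat) (hn : (1 <= n)%N) :
  closure (convex_hull (constructible_region R n)) = BT R n.
Proof.
apply/seteqP; split; last exact: BT_sub_closure.
rewrite [X in _ `<=` X](closure_id _).1; last exact: closed_BT.
apply: closure_subset; apply: convex_hull_sub; last exact: convex_BT.
exact: constructible_BT.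
Qed.
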